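(* Let $v>0$ and $r\ge0$. The topological entropy $h_{\mathrm{top}}(T_v)$ of the traffic map in continuum $T_v$, $(T_vx)_i=\min\{x_i+v,\ x_{i+1}-2r\}$, acting on the space of admissible configurations in $\mathbb{R}$, is infinite.
   Context: For $r\ge0$ an admissible configuration is a bi-infinite sequence $x=(x_i)_{i\in\mathbb{Z}}$ of real numbers with $x_i+r\le x_{i+1}-r$ for all $i$; $X=X(r,\mathbb{R})$ is the set of admissible configurations, with the topology and the $\sigma$-algebra generated by the finite cylinders $\{x:x_i\in C_i\ \forall i\in I\}$ ($I\subset\mathbb{Z}$ finite, $C_i$ open intervals). $T_v$ is the map corresponding to the deterministic process $\pi(p=1,v,r,\mathbb{R})$. When speaking of invariant measures, particles are regarded as indistinguishable: configurations $x,x'$ with $x'_i=x_{i+k}$ for some $k\in\mathbb{Z}$ and all $i$ are identified, the quotient carries the quotient topology and $\sigma$-algebra, and $T_v$ is regarded as acting on the quotient. The topological entropy $h_{\mathrm{top}}(T_v)$ is by definition the supremum of the metric (Kolmogorov–Sinai) entropies of $T_v$ over all $T_v$-invariant probability measures. *)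

(* Defs.v *)
From HB Require Import structures.
From mathcomp Require Import all_boot all_order all_algebra.
From mathcomp Require Import all_classical all_reals all_analysis.
From mathcomp Require Import measurable_realfun lra.

Set Implicit Arguments.
Unset Strict Implicit.
Unset Printing Implicit Defensive.

Import Order.TTheory GRing.Theory Num.Theory.
Import numFieldNormedType.Exports.

Local Open Scope classical_set_scope.
Local Open Scope ring_scope.
Local Open Scope quotient_scope.

Section KolmogorovSinai.
Context {d : measure_display} {Y : measurableType d} {R : realType}.
Implicit Types (mu : probability Y R) (T : Y -> Y).

Definition invariant_measure T mu :=
  forall A, measurable A -> mu (T @^-1` A) = mu A.

(* Cells are indexed, and may be empty. *)
Definition measurable_partition (k : nat) (P : 'I_k -> set Y) :=
  [/\ forall i, measurable (P i), trivIset setT P & \bigcup_i P i = setT].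

(* Empty or null cells contribute 0, since [ln 0 = 0]. *)
Definition partition_entropy mu (I : finType) (P : I -> set Y) : R :=
  - \sum_i fine (mu (P i)) * ln (fine (mu (P i))).

(* The cells of the join of T^-j P for 0 <= j < n are indexed by the
   itineraries w. *)
Definition join_partition T (k : nat) (P : 'I_k -> set Y) (n : nat)
    (w : {ffun 'I_n -> 'I_k}) : set Y :=
  \bigcap_(j in [set: 'I_n]) (iter j T @^-1` P (w j)).

(* [limn] is a total operator; for invariant mu the limit exists by
   subadditivity. *)
Definition entropy_wrt T mu (k : nat) (P : 'I_k -> set Y) : \bar R :=
  limn (fun n : nat =>
    (partition_entropy mu (join_partition T P (n := n)) / n%:R)%:E).

Definition metric_entropy T mu : \bar R :=
  ereal_sup [set h | exists k (P : 'I_k -> set Y),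
    measurable_partition P /\ h = entropy_wrt T mu P].

End KolmogorovSinai.

(* Defined as the supremum of the metric entropies over all invariant
   probability measures; no topology on Y is involved. *)
Definition topological_entropy {d : measure_display} {Y : measurableType d}
    (R : realType) (T : Y -> Y) : \bar R :=
  ereal_sup [set metric_entropy T mu |
    mu in [set mu : probability Y R | invariant_measure T mu]].

Section Configurations.
Context {R : realType}.

Definition admissible (r : R) (x : int -> R) :=
  forall i, x i + r <= x (i + 1) - r.

Record configuration (r : R) := Configuration {
  position :> int -> R ;
  _ : `[< admissible r position >] }.

HB.instance Definition _ r := [isSub for @position r].
HB.instance Definition _ r := [Choice of configuration r by <:].

Variable r : R.
Implicit Types x y z : configuration r.

Lemma configurationP x : admissible r x.
Proof. by case: x => f Pf; exact: (asboolW Pf). Qed.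

Lemma admissible_lattice : admissible r (fun i => (r + r) * i%:~R).
Proof. by move=> i; rewrite intrD; lra. Qed.

HB.instance Definition _ :=
  isPointed.Build (configuration r) (Configuration (asboolT admissible_lattice)).

(* Open intervals, possibly unbounded or empty. *)
Definition finite_cylinders : set (set (configuration r)) :=
  [set A | exists (I : set int) (C : int -> set R),
    [/\ finite_set I, forall i, open (C i) /\ is_interval (C i) &
        A = [set x : configuration r | forall i, I i -> C i (x i)]]].

HB.instance Definition _ := Measurable.copy (configuration r)
  (g_sigma_algebraType finite_cylinders).

Definition shift_equiv x y := `[< exists k : int, forall i, y i = x (i + k) >].

Lemma shift_equiv_refl : reflexive shift_equiv.
Proof. by move=> x; apply/asboolP; exists 0 => i; rewrite addr0. Qed.

Lemma shift_equiv_sym : symmetric shift_equiv.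
Proof.
suff sub x y : shift_equiv x y -> shift_equiv y x.
  by move=> x y; apply/idP/idP; exact: sub.
by move=> /asboolP[k xy]; apply/asboolP; exists (- k) => i; rewrite xy addrNK.
Qed.

Lemma shift_equiv_trans : transitive shift_equiv.
Proof.
move=> y x z /asboolP[k xy] /asboolP[l yz]; apply/asboolP; exists (l + k) => i.
by rewrite yz xy addrA.
Qed.

Canonical shift_equiv_rel :=
  EquivRel shift_equiv shift_equiv_refl shift_equiv_sym shift_equiv_trans.

(* Configurations of indistinguishable particles. *)
Definition unlabelled := {eq_quot shift_equiv_rel}.

HB.instance Definition _ := Choice.on unlabelled.
HB.instance Definition _ := Quotient.on unlabelled.
HB.instance Definition _ := isPointed.Build unlabelled (\pi_unlabelled point).

Definition unlabelled_measurable : set (set unlabelled) :=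
  image_set_system setT (\pi_unlabelled : configuration r -> unlabelled)
    measurable.

Lemma unlabelled_measurableE (A : set unlabelled) :
  unlabelled_measurable A = measurable (\pi_unlabelled @^-1` A).
Proof. by rewrite /unlabelled_measurable /image_set_system /= setTI. Qed.

Let unlabelled_measurable0 : unlabelled_measurable set0.
Proof. by rewrite unlabelled_measurableE preimage_set0; exact: measurable0. Qed.

Let unlabelled_measurableC A :
  unlabelled_measurable A -> unlabelled_measurable (~` A).
Proof.
by rewrite !unlabelled_measurableE -preimage_setC; exact: measurableC.
Qed.

Let unlabelled_measurable_bigcup (F : (set unlabelled)^nat) :
  (forall i, unlabelled_measurable (F i)) ->
  unlabelled_measurable (\bigcup_i F i).
Proof.
move=> mF; rewrite unlabelled_measurableE preimage_bigcup.
by apply: bigcupT_measurable => i; rewrite -unlabelled_measurableE.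
Qed.

Fact unlabelled_display : measure_display. Proof. by []. Qed.

HB.instance Definition _ := isMeasurable.Build unlabelled_display unlabelled
  unlabelled_measurable0 unlabelled_measurableC unlabelled_measurable_bigcup.

End Configurations.

Section TrafficMap.
Context {R : realType} (r v : R) (v_gt0 : 0 < v).
Implicit Types x : configuration r.

Definition traffic_fun (x : int -> R) (i : int) : R :=
  Num.min (x i + v) (x (i + 1) - 2 * r).

Lemma admissible_traffic (x : configuration r) : admissible r (traffic_fun x).
Proof.
move=> i; rewrite /traffic_fun.
have := configurationP x i; have := configurationP x (i + 1).
have := v_gt0; rewrite !minEle.
by case: ifPn; case: ifPn; rewrite -?ltNge; lra.
Qed.

Definition traffic_configuration x : configuration r :=
  Configuration (asboolT (admissible_traffic x)).

(* The map induced on unlabelled configurations; independence of the chosen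
   representative is [traffic_map_pi]. *)
Definition traffic_map (q : unlabelled r) : unlabelled r :=
  \pi_(unlabelled r) (traffic_configuration (repr q)).

Lemma traffic_map_pi x :
  traffic_map (\pi_(unlabelled r) x) =
  \pi_(unlabelled r) (traffic_configuration x).
Proof.
apply/eqmodP/asboolP.
have /eqmodP/asboolP[k xk] : repr (\pi_(unlabelled r) x) = x %[mod unlabelled r].
  by rewrite reprK.
by exists k => i; rewrite /= /traffic_fun !xk addrAC.
Qed.

Lemma measurable_position (i : int) :
  measurable_fun setT (fun x : configuration r => x i).
Proof.
apply: (measurability _ (RGenOInfty.measurableE R)) => _ [_ [a ->] <-].
rewrite setTI; apply: sub_sigma_algebra.
exists [set i], (fun=> `]a, +oo[%classic); split.
- exact: finite_set1.
- by move=> _; split; [exact: interval_open | exact: interval_is_interval].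
- by apply/seteqP; split => x /= h; [move=> _ ->|apply: h].
Qed.

Lemma measurable_traffic_configuration :
  measurable_fun setT traffic_configuration.
Proof.
apply: (measurability (@finite_cylinders R r) erefl).
move=> _ [_ [I [C [finI openC ->]]] <-]; rewrite setTI.
have -> : traffic_configuration @^-1` [set x : configuration r | forall i, I i -> C i (x i)] =
    \bigcap_(i in I) ((fun x => traffic_fun (position x) i) @^-1` C i).
  by apply/seteqP; split => x.
apply: fin_bigcap_measurable => // i _.
rewrite -[X in measurable X]setTI.
have mf : measurable_fun setT
    (fun x : configuration r => traffic_fun (position x) i).
  apply: measurable_minr.
  - by apply: measurable_funD => //; exact: measurable_position.
  - by apply: measurable_funB => //; exact: measurable_position.
by apply: mf => //; apply: open_measurable; have [] := openC i.
Qed.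

Lemma measurable_traffic_map : measurable_fun setT traffic_map.
Proof.
move=> _ A mA; rewrite setTI.
suff : unlabelled_measurable (traffic_map @^-1` A) by [].
have {}mA : measurable (\pi_(unlabelled r) @^-1` A).
  by rewrite -unlabelled_measurableE.
rewrite unlabelled_measurableE.
have -> : \pi_(unlabelled r) @^-1` (traffic_map @^-1` A) =
    traffic_configuration @^-1` (\pi_(unlabelled r) @^-1` A).
  by apply/seteqP; split => x /=; rewrite traffic_map_pi.
rewrite -[X in measurable X]setTI.
exact: measurable_traffic_configuration.
Qed.

End TrafficMap.

(* Main.v *)
From HB Require Import structures.
Require Import Defs.
From mathcomp Require Import all_boot all_order all_algebra.
From mathcomp Require Import all_classical all_reals all_analysis.
From mathcomp Require Import lra ring zify.
Import Order.TTheory GRing.Theory Num.Theory.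
Import numFieldNormedType.Exports.

(** Where consecutive gaps are at least [v + 2 r], every particle moves freely
    and the traffic map is the translation by [v].  Choose [m] with
    [m v >= 2 v + 2 r] and put one particle in each block of length [m v], at
    the left end of the block displaced by one of [B] offsets [a v / B],
    [a < B].  The displacements are less than [v], so the gaps stay at least
    [v + 2 r] and the configuration is only translated, for ever
    ([traffic_spaced]).  With independent uniform offsets, the translation by
    [m v] is a Bernoulli shift on [B] symbols once labels are forgotten
    ([spaced_relabel]).  Hence the mixture of the [m] translates by [v], [2 v],
    ..., [m v] of this random configuration is an invariant law
    ([mixture_invariant]).

    Its entropy is [ln B / m] already for the partition that records the first
    position [a v / B] that is occupied, if any: in component [k < m]
    of the mixture, an itinerary of length [n] reveals exactly
    [(n + k) / m] independent offsets, so it has probability [0] or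
    [B ^ - ((n + k) / m)] ([phase_join]).  In the mixture every itinerary that
    occurs thus has probability [B ^ - (n / m)] up to a factor bounded
    independently of [n], which determines the growth rate of the entropy of
    the joins ([entropy_wrt_uniform]).  Since [m] depends only on [r] and [v]
    while [B] is arbitrary, the supremum is infinite.

    The two-sided sequence of independent offsets is read off from a single
    uniform point of the unit interval: its digits in base [B] are independent
    and uniform, and they can be indexed by the integers along any injection
    into the naturals ([digits_independent]).  Any two injections
    produce the same law ([random_spaced_law]), which is the shift invariance
    that is needed. *)

Set Implicit Arguments.
Unset Strict Implicit.
Unset Printing Implicit Defensive.

Local Open Scope classical_set_scope.
Local Open Scope ring_scope.
Local Open Scope quotient_scope.

(** * Independence of the digits of a uniform random point *)

Lemma measure_fin_disjoint d (T : measurableType d) (R : realType)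
    (mu : {measure set T -> \bar R}) (I : finType) (P : pred I)
    (F : I -> set T) :
    (forall i, measurable (F i)) -> trivIset setT F ->
  mu (\bigcup_(i in [set` P]) F i) = (\sum_(i | P i) mu (F i))%E.
Proof.
move=> mF tF; rewrite measure_fin_bigcup//; last exact: sub_trivIset tF.
rewrite -[RHS]big_filter [in RHS]fsbig_seq; last first.
  by rewrite filter_uniq// index_enum_uniq.
apply: eq_fsbigl; apply/seteqP.
by split => i /=; rewrite mem_filter mem_index_enum andbT.
Qed.

Section UniformDigits.
Context {R : realType} (b : nat).
Local Notation base := b.+1.

(** The half-open interval is taken because the point [1] has the same digits as
    [0]. *)
Definition unit_measure : set (measurableTypeR R) -> \bar R :=
  mrestr lebesgue_measure (measurable_itv (`[0, 1[ : interval R)).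

HB.instance Definition _ := Measure.copy unit_measure
  (mrestr lebesgue_measure (measurable_itv (`[0, 1[ : interval R))).

Let unit_measureT : unit_measure setT = 1%E.
Proof.
rewrite /unit_measure /mrestr setTI lebesgue_measure_itv/= lte_fin ltr01.
by rewrite oppr0 adde0.
Qed.

HB.instance Definition _ :=
  Measure_isProbability.Build _ _ R unit_measure unit_measureT.

Definition digit (j : nat) (u : R) : 'I_base :=
  Ordinal (ltn_pmod (Num.truncn (base%:R ^+ j.+1 * u)) (ltn0Sn b)).

Lemma measurable_digit j (D : pred 'I_base) :
  measurable [set u | D (digit j u)].
Proof.
have mt n : measurable [set u : R | Num.truncn (base%:R ^+ j.+1 * u) = n].
  have ml k : measurable [set u : R | (Num.truncn (base%:R ^+ j.+1 * u) < k)%N].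
    case: k => [|k].
      by rewrite (_ : mkset _ = set0) //; apply/seteqP; split.
    rewrite (_ : mkset _ = `]-oo, k.+1%:R / base%:R ^+ j.+1[%classic).
      exact: measurable_itv.
    apply/seteqP; split => u /=; rewrite ltnS truncn_le_nat in_itv/=;
      by rewrite ltr_pdivlMr ?exprn_gt0// mulrC.
  rewrite (_ : mkset _ =
      [set u : R | (Num.truncn (base%:R ^+ j.+1 * u) < n.+1)%N] `\`
      [set u : R | (Num.truncn (base%:R ^+ j.+1 * u) < n)%N]).
    exact: measurableD.
  apply/seteqP; split => u /=; first by move=> ->; rewrite ltnSn ltnn.
  rewrite ltnS => -[h /negP]; rewrite -leqNgt => h'.
  by apply/eqP; rewrite eqn_leq h h'.
rewrite (_ : mkset _ =
  \bigcup_(n in [set n | D (Ordinal (ltn_pmod n (ltn0Sn b)))])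
  [set u : R | Num.truncn (base%:R ^+ j.+1 * u) = n]).
  by apply: bigcup_measurable => n _; exact: mt.
apply/seteqP; split => u /= => [Du|[n /= Dn un]]; last by rewrite /digit un.
by eexists; first exact: Du.
Qed.

Lemma truncn_digit (u : R) n : 0 <= u ->
  Num.truncn (base%:R ^+ n.+1 * u) =
  (Num.truncn (base%:R ^+ n * u) * base + digit n u)%N.
Proof.
move=> u0; rewrite /= [LHS](divn_eq _ base); congr (_ * _ + _)%N.
apply/esym/eqP; rewrite truncn_eq; last by rewrite mulr_ge0 ?exprn_ge0.
set t := Num.truncn _.
have /andP[lo hi] : t%:R <= base%:R ^+ n.+1 * u < t.+1%:R.
  by rewrite truncn_itv// mulr_ge0 ?exprn_ge0.
rewrite exprS -mulrA mulrC in lo hi.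
have base0 : 0 < base%:R :> R by [].
rewrite -(ler_pM2r base0) -(ltr_pM2r base0) -!natrM.
rewrite (le_trans _ lo) ?ler_nat ?leq_trunc_div//= (lt_le_trans hi)// ler_nat.
by rewrite -ltn_divLR.
Qed.

(** The prefix is the base-[b.+1] expansion of the number [a] of the [n]-th
    level cell that contains [u]. *)
Lemma digit_prefix n (w : nat -> 'I_base) : exists2 a : nat, (a < base ^ n)%N &
  forall u : R, 0 <= u < 1 ->
    (forall j, (j < n)%N -> digit j u = w j) <-> Num.truncn (base%:R ^+ n * u) = a.
Proof.
elim: n => [|n [a ale IH]].
  exists 0%N => // u /andP[u0 u1]; split => // _.
  by apply/eqP; rewrite mul1r truncn_eq// u0.
exists (a * base + w n)%N.
  rewrite expnSr; apply: (@leq_trans (a.+1 * base)); rewrite ?leq_mul2r//.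
  by rewrite mulSnr ltn_add2l.
move=> u u01; have /andP[u0 u1] := u01; rewrite truncn_digit//; split => [dw|e].
  rewrite dw//; congr (_ * _ + _)%N; apply/IH => // j jn; exact/dw/ltnW.
have da : Num.truncn (base%:R ^+ n * u) = a.
  by move/(congr1 (divn^~ base)): e; rewrite !divnMDl// !divn_small// !addn0.
have dn : digit n u = w n.
  by apply: val_inj; move: e; rewrite da => /addnI.
move=> j; rewrite ltnS leq_eqVlt => /orP[/eqP -> //|].
exact: (proj2 (IH u u01) da).
Qed.

Lemma unit_measure_prefix n (w : nat -> 'I_base) :
  unit_measure [set u | forall j, (j < n)%N -> digit j u = w j] =
  ((base%:R ^- n)%:E)%E.
Proof.
have [a ale aP] := digit_prefix n w.
have B0 : 0 < base%:R ^+ n :> R by rewrite exprn_gt0.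
have -> : unit_measure [set u | forall j, (j < n)%N -> digit j u = w j] =
    lebesgue_measure (`[a%:R / base%:R ^+ n, a.+1%:R / base%:R ^+ n[ : set R).
  rewrite /unit_measure /mrestr; congr lebesgue_measure.
  apply/seteqP; split => u /=; rewrite !in_itv/= ler_pdivrMr// ltr_pdivlMr//.
    move=> [dw /[dup] u01 /andP[u0 u1]]; move/(aP u u01): dw => <-.
    by rewrite mulrC truncn_itv// mulr_ge0// ltW.
  move=> /andP[lo hi].
  have u01 : 0 <= u < 1.
    apply/andP; split; first by rewrite -(pmulr_lge0 _ B0) (le_trans _ lo).
    by rewrite -(ltr_pM2r B0) mul1r (lt_le_trans hi)// -natrX ler_nat.
  by split => //; apply/(aP u u01); apply: truncn_def; rewrite mulrC lo hi.
rewrite lebesgue_measure_itv/= lte_fin ltr_pM2r ?invr_gt0// ltr_nat ltnSn.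
by rewrite -EFinB -mulrBl -natrB// subSnn mul1r.
Qed.

(** The event is a disjoint union of prefix cells of the same length, as many as
    there are words with letters in [D]. *)
Lemma unit_measure_digits n (D : nat -> pred 'I_base) :
  unit_measure [set u | forall j, (j < n)%N -> D j (digit j u)] =
  (\prod_(j < n) (#|D j|%:R / base%:R))%:E.
Proof.
(* The default letter [ord0] is never reached: only [j < n] matters. *)
pose w (W : {ffun 'I_n -> 'I_base}) (j : nat) := oapp W ord0 (insub j).
have wE W (j : 'I_n) : w W j = W j by rewrite /w valK.
pose cell W := [set u | forall j, (j < n)%N -> digit j u = w W j].
pose F := family (fun j : 'I_n => D j).
have -> : [set u | forall j, (j < n)%N -> D j (digit j u)] =
    \bigcup_(W in [set` F]) cell W.
  apply/seteqP; split => u /= => [Du|[W /= /familyP FW uW] j jn].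
    exists [ffun j : 'I_n => digit j u].
      by apply/familyP => j; rewrite ffunE; exact: Du.
    by move=> j jn; rewrite (wE _ (Ordinal jn)) ffunE.
  by rewrite uW// (wE _ (Ordinal jn)); exact: (FW (Ordinal jn)).
have mcell W : measurable (cell W).
  rewrite (_ : cell W = \bigcap_(j in [set j | (j < n)%N])
      [set u | pred1 (w W j) (digit j u)]).
    apply: fin_bigcap_measurable => [|j _]; first exact: finite_II.
    exact: measurable_digit.
  by apply/seteqP; split => u uW j /= jn; apply/eqP; exact: uW.
rewrite measure_fin_disjoint//; last first.
  by move=> W W' _ _ [u [uW uW']]; apply/ffunP => j; rewrite -!wE -uW// uW'.
rewrite (eq_bigr (fun=> (base%:R ^- n)%:E)); last first.
  by move=> W _; exact: unit_measure_prefix.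
rewrite sumEFin sumr_const card_family foldrE big_map big_enum/= big_split/=.
by congr EFin; rewrite prodr_const card_ord exprVn -[LHS]mulr_natl natr_prod.
Qed.

(** Independence of the digits read along an injection: the positions that are
    not read impose no constraint and contribute a factor [1]. *)
Lemma digits_independent (T : eqType) (f : T -> nat) (s : seq T)
    (D : T -> pred 'I_base) : injective f -> uniq s ->
  unit_measure [set u | forall i, i \in s -> D i (digit (f i) u)] =
  (\prod_(i <- s) (#|D i|%:R / base%:R))%:E.
Proof.
move=> f_inj us; pose n := (\max_(i <- s) f i).+1.
have sn i : i \in s -> (f i < n)%N by move=> si; rewrite ltnS leq_bigmax_seq.
pose D' j : pred 'I_base :=
  if [seq i <- s | f i == j] is i :: _ then D i else predT.
have D'E i : i \in s -> D' (f i) = D i.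
  move=> si; rewrite /D' (eq_filter (a2 := pred1 i)) ?filter_pred1_uniq//.
  by move=> k; exact: inj_eq.
have D'P j : (exists2 i, i \in s & f i = j) \/ D' j = predT.
  rewrite /D'; case sj: [seq i <- s | f i == j] => [|i t]; [by right|left].
  have : i \in [seq i <- s | f i == j] by rewrite sj mem_head.
  by rewrite mem_filter => /andP[/eqP fi si]; exists i.
have -> : [set u | forall i, i \in s -> D i (digit (f i) u)] =
    [set u | forall j, (j < n)%N -> D' j (digit j u)].
  apply/seteqP; split => u /= Du => [j jn|i si].
    by case: (D'P j) => [[i si <-]|-> //]; rewrite D'E//; exact: Du.
  by rewrite -D'E//; apply/Du/sn.
rewrite unit_measure_digits; congr EFin.
rewrite -(big_mkord xpredT (fun j => #|D' j|%:R / base%:R)).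
rewrite (bigID (mem (map f s)))/=.
rewrite [X in _ * X]big1 ?mulr1 => [|j js].
  rewrite -big_filter (perm_big (map f s)); last first.
    apply: uniq_perm; [by rewrite filter_uniq// iota_uniq|by rewrite map_inj_uniq|].
    move=> j; rewrite mem_filter; apply: andb_idr => /mapP[i si ->].
    by rewrite mem_index_iota/= sn.
  by rewrite big_map; apply: eq_big_seq => i si; rewrite D'E.
have [[i si fi]|->] := D'P j; last by rewrite card_ord divff.
by rewrite -fi map_f in js.
Qed.

End UniformDigits.

(** * Entropy when all itineraries are about equally likely *)

Section Entropy.
Context {d : measure_display} {Y : measurableType d} {R : realType}.
Implicit Types (mu : probability Y R) (T : Y -> Y).

(** The entropy is the mean of [- ln mu (P i)] over the cell [P i] of a random
    point, and [A], [B] bound the values that this quantity averages. *)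
Lemma partition_entropy_bounds mu (I : finType) (P : I -> set Y) (A B : R) :
  (forall i, measurable (P i)) -> trivIset setT P -> \bigcup_i P i = setT ->
  0 < A ->
  (forall i, fine (mu (P i)) != 0 -> A <= fine (mu (P i)) <= B) ->
  - ln B <= partition_entropy mu P <= - ln A.
Proof.
move=> mP tP cP A0 AB.
have sum1 : \sum_i fine (mu (P i)) = 1.
  rewrite sum_fine; last by move=> i _; exact: fin_num_measure.
  have <- := measure_fin_disjoint mu predT mP tP.
  rewrite (_ : [set` predT] = setT).
    by rewrite cP; exact: (congr1 fine (probability_setT mu)).
  by apply/seteqP; split.
have q0 i : 0 <= fine (mu (P i)) by rewrite fine_ge0.
rewrite /partition_entropy !lerN2 -[ln B]mul1r -[ln A]mul1r -sum1 !mulr_suml.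
apply/andP; split; apply: ler_sum => i _;
  have [->|/[dup] /AB /andP[Aq qB] qn0] := eqVneq (fine (mu (P i))) 0;
  rewrite ?mul0r//;
  rewrite ler_wpM2l// ler_ln// posrE ?(lt_le_trans A0)//.
exact: le_trans qB.
Qed.

Lemma measurable_iter T j : measurable_fun setT T -> measurable_fun setT (iter j T).
Proof.
by move=> mT; elim: j => [|j IH]; [exact: measurable_id|exact: measurableT_comp].
Qed.

Lemma join_partition_measurable T k (P : 'I_k -> set Y) n (w : {ffun 'I_n -> 'I_k}) :
  measurable_fun setT T -> (forall i, measurable (P i)) ->
  measurable (join_partition T P w).
Proof.
move=> mT mP; apply: fin_bigcap_measurable => // j _.
by rewrite -[X in measurable X]setTI; exact: measurable_iter.
Qed.

Lemma join_partition_disjoint T k (P : 'I_k -> set Y) n :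
  trivIset setT P -> trivIset setT (join_partition T P (n := n)).
Proof.
move=> tP w w' _ _ [y [yw yw']]; apply/ffunP => j.
by apply: (tP (w j) (w' j)) => //; exists (iter j T y); split; [exact: yw|exact: yw'].
Qed.

Lemma join_partition_cover T k (P : 'I_k -> set Y) n :
  \bigcup_i P i = setT -> \bigcup_w join_partition T P (n := n) w = setT.
Proof.
move=> cP; apply/seteqP; split => // y _.
have ex z : exists i, P i z.
  have : (\bigcup_i P i) z by rewrite cP.
  by move=> [i _ Pz]; exists i.
pose c z := sval (cid (ex z)).
exists [ffun j : 'I_n => c (iter j T y)] => // j _ /=.
by rewrite ffunE; exact: (svalP (cid (ex _))).
Qed.

(** Masses known up to a bounded factor determine [- ln] of them up to a bounded
    error [K], which disappears after division by [n]. *)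
Lemma entropy_wrt_uniform T mu k (P : 'I_k -> set Y) (m B : nat) :
  measurable_fun setT T -> measurable_partition P -> (0 < m)%N -> (0 < B)%N ->
  (forall n (w : {ffun 'I_n -> 'I_k}),
    let q := fine (mu (join_partition T P w)) in
    q != 0 -> m%:R^-1 * B%:R ^- (n %/ m).+1 <= q <= B%:R ^- (n %/ m)) ->
  entropy_wrt T mu P = (ln (B%:R : R) / m%:R)%:E.
Proof.
move=> mT [mP tP cP] m0 B0 qP; rewrite /entropy_wrt; apply: cvg_lim => //.
apply: cvg_EFin; first by near=> n.
(* One letter of slack from the rounding of [n / m], and the factor [m]. *)
pose lB : R := ln B%:R; pose K : R := lB + ln m%:R.
have lB0 : 0 <= lB by rewrite ln_ge0// ler1n.
have lm0 : 0 <= ln (m%:R : R) by rewrite ln_ge0// ler1n.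
pose e n : R := K / n%:R.
have e0 : e n @[n --> \oo] --> (0 : R).
  rewrite -(mulr0 K); apply: cvgMr; apply/(@gtr0_cvgV0 R nat \oo).
    by near=> n; rewrite ltr0n; near: n; exact: nbhs_infty_gt.
  exact: cvgr_idn.
have lo : lB / m%:R - e n @[n --> \oo] --> lB / m%:R.
  by rewrite -[X in _ --> X]subr0; apply: cvgB => //; exact: cvg_cst.
have hi : lB / m%:R + e n @[n --> \oo] --> lB / m%:R.
  by rewrite -[X in _ --> X]addr0; apply: cvgD => //; exact: cvg_cst.
apply: squeeze_cvgr lo hi; near=> n.
have n0 : 0 < n%:R :> R by rewrite ltr0n; near: n; exact: nbhs_infty_gt.
have m0R : 0 < m%:R :> R by rewrite ltr0n.
have B0R : 0 < B%:R :> R by rewrite ltr0n.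
have A0 : 0 < m%:R^-1 * B%:R ^- (n %/ m).+1 :> R.
  by rewrite mulr_gt0 ?invr_gt0// exprn_gt0.
have := partition_entropy_bounds (mu := mu)
  (fun w => join_partition_measurable w mT mP)
  (@join_partition_disjoint T k P n tP)
  (@join_partition_cover T k P n cP) A0 (qP n).
rewrite lnM ?posrE ?invr_gt0 ?exprn_gt0// !lnV ?posrE ?exprn_gt0// !lnXn//.
rewrite !opprK opprB opprK.
rewrite -/lB -[_ *+ (n %/ m)]mulr_natr -[_ *+ _.+1]mulr_natr.
set q := (n %/ m)%N => /andP[lH Hh].
have qlo : n%:R < q.+1%:R * m%:R :> R by rewrite -natrM ltr_nat ltn_ceil.
have qhi : q%:R * m%:R <= n%:R :> R by rewrite -natrM ler_nat leq_trunc_div.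
have nE : n%:R / m%:R * m%:R = n%:R :> R by rewrite divfK// gt_eqF.
rewrite ler_pdivlMr// ler_pdivrMr// !mulrDl mulNr /e !divfK ?gt_eqF//.
have t1 : n%:R / m%:R <= q.+1%:R :> R by rewrite ler_pdivrMr// ltW.
have t2 : q%:R <= n%:R / m%:R :> R by rewrite ler_pdivlMr.
rewrite -natr1 in t1 Hh.
have := ler_wpM2l lB0 t1; have := ler_wpM2l lB0 t2.
rewrite mulrDr mulr1 mulrA [lB / _ * _]mulrAC /K -/lB => u1 u2.
move: Hh; rewrite mulrDr mulr1 => Hh.
by apply/andP; split; lra.
Unshelve. all: by end_near.
Qed.

End Entropy.

(** * Free flow of spaced particles *)

Section FreeFlow.
Context {R : realType} (r v : R) (r_ge0 : 0 <= r) (v_gt0 : 0 < v) (b m : nat).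
Hypothesis room : v + v + (r + r) <= m%:R * v.
Local Notation base := b.+1.
Implicit Types (w : int -> 'I_base) (p : nat).

Lemma spacing_gt0 : (0 < m)%N.
Proof.
rewrite -(ltr0n R) -(pmulr_lgt0 _ v_gt0).
by have := v_gt0; have := room; have := r_ge0; lra.
Qed.

Definition offset (a : 'I_base) : R := a%:R / base%:R * v.

Lemma offset_itv a : 0 <= offset a < v.
Proof.
rewrite /offset mulr_ge0 ?divr_ge0 ?(ltW v_gt0)//= gtr_pMl// ltr_pdivrMr// mul1r.
by rewrite ltr_nat.
Qed.

(** A word [w] of offsets, carried by blocks of length [m v] that have already
    been translated [p] times by [v]. *)
Definition spaced_position w p (i : int) : R :=
  (i * m%:Z + p%:Z)%:~R * v + offset (w i).

Lemma spaced_positionS w p i :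
  spaced_position w p (i + 1) =
  spaced_position w p i + m%:R * v + (offset (w (i + 1)) - offset (w i)).
Proof.
rewrite /spaced_position mulrDl mul1r addrAC [(_ + m%:Z)%:~R]intrD -pmulrn.
by ring.
Qed.

Lemma admissible_spaced w p : admissible r (spaced_position w p).
Proof.
move=> i; rewrite spaced_positionS; have := room; have := v_gt0.
have /andP[] := offset_itv (w i); have /andP[] := offset_itv (w (i + 1)).
by lra.
Qed.

Definition spaced w p : configuration r :=
  Configuration (asboolT (admissible_spaced w p)).

(** Two offsets differ by less than [v], so every gap exceeds
    [m v - v >= v + 2 r], and the leader never obstructs. *)
Lemma traffic_spaced w p :
  traffic_configuration v_gt0 (spaced w p) = spaced w p.+1.
Proof.
apply: val_inj; apply/funext => i; rewrite /= /traffic_fun spaced_positionS min_l.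
  by rewrite /spaced_position -[in RHS]addn1 PoszD addrA [in RHS]intrD; ring.
have := room; have := v_gt0.
have /andP[] := offset_itv (w i); have /andP[] := offset_itv (w (i + 1)).
by lra.
Qed.

Lemma iter_traffic_spaced w p j :
  iter j (traffic_map v_gt0) (\pi_(unlabelled r) (spaced w p)) =
  \pi_(unlabelled r) (spaced w (p + j)).
Proof.
elim: j => [|j IH]; first by rewrite addn0.
by rewrite iterS IH traffic_map_pi traffic_spaced addnS.
Qed.

(** After [m] steps every block has moved onto the next one, which forgetting
    the labels turns into a shift of the word. *)
Lemma spaced_relabel w p :
  \pi_(unlabelled r) (spaced w (p + m)) =
  \pi_(unlabelled r) (spaced (fun i => w (i - 1)) p).
Proof.
apply/eqmodP/asboolP; exists (-1) => i /=; rewrite /spaced_position.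
by congr (_%:~R * _ + _); rewrite PoszD; ring.
Qed.

(** The sets of configurations with a particle at a given offset; from index
    [b.+1] on, the whole space, so that the index [b.+1] collects in
    [offset_partition] the configurations with none of the offsets occupied. *)
Definition occupied (a : nat) : set (unlabelled r) :=
  if insub a is Some c then
    [set q | exists i, (repr q : configuration r) i = offset c]
  else setT.

Lemma occupied_pi (a : 'I_base) (x : configuration r) :
  occupied a (\pi_(unlabelled r) x) <-> exists i, x i = offset a.
Proof.
rewrite /occupied valK /=.
have /eqmodP/asboolP[k xk] : x = repr (\pi_(unlabelled r) x) %[mod unlabelled r].
  by rewrite reprK.
split=> -[i xi]; first by exists (i + k); rewrite -xk.
by exists (i - k); rewrite xk subrK.
Qed.

Lemma measurable_occupied a : measurable (occupied a).
Proof.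
rewrite /occupied; case: insubP => [c _ ca|_]; last exact: measurableT.
suff : unlabelled_measurable (occupied c).
  by rewrite /occupied valK.
rewrite unlabelled_measurableE.
rewrite (_ : _ @^-1` _ =
    \bigcup_(i in [set: int])
      ((fun x : configuration r => x i) @^-1` [set offset c])).
  apply: countable_bigcupT_measurable => // i; rewrite -[X in measurable X]setTI.
  by apply: measurable_position => //; exact: measurable_set1.
apply/seteqP; split => x /=.
  by move/occupied_pi => [i xi]; exists i.
by move=> [i _ xi]; apply/occupied_pi; exists i.
Qed.

Definition offset_partition (a : 'I_base.+1) : set (unlabelled r) :=
  seqDU occupied a.

Lemma offset_partitionP : measurable_partition offset_partition.
Proof.
split.
- move=> a; apply: measurableD; first exact: measurable_occupied.
  by apply: bigsetU_measurable => k _; exact: measurable_occupied.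
- move=> a a' _ _ h; apply: val_inj.
  exact: (@trivIset_seqDU _ occupied a a' Logic.I Logic.I h).
- apply/seteqP; split => // q _.
  have : (\bigcup_k (seqDU occupied k)) q.
    by rewrite -seqDU_bigcup_eq; exists base => //; rewrite /occupied insubF// ltnn.
  move=> [k _ kq]; have [kb|kb] := ltnP k base.+1; first by exists (Ordinal kb).
  move: kq => [_]; case; rewrite -bigcup_mkord; exists base => //=.
  by rewrite /occupied insubF// ltnn.
Qed.

(** What the partition sees of the [p]-th translate: the window [0, v) meets the
    start of a block only when [m] divides [p], and then it is the block with
    index [- (p / m)]. *)
Definition symbol w p : 'I_base.+1 :=
  if (m %| p)%N then widen_ord (leqnSn base) (w (- (p %/ m)%:Z)) else ord_max.

(** Offsets lie in [0, v), so a difference of two of them is a multiple of [v]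
    only if it vanishes. *)
Lemma int_offset_eq (k : int) (a c : 'I_base) :
  k%:~R * v + offset c = offset a -> k = 0 /\ a = c.
Proof.
move=> e; have k0 : k = 0.
  have /andP[a0 av] := offset_itv a; have /andP[c0 cv] := offset_itv c.
  have k1 : k%:~R * v < 1 * v by lra.
  have k2 : -1 * v < k%:~R * v by lra.
  move: k1 k2; rewrite !ltr_pM2r// -[1]/(1%:~R) -mulrNz !ltr_int => k1 k2.
  by lia.
split => //; apply: val_inj; apply/eqP.
move: e; rewrite k0 mul0r add0r /offset => /(mulIf (lt0r_neq0 v_gt0)).
have B0 : (base%:R : R)^-1 != 0 by rewrite invr_eq0 pnatr_eq0.
by move=> /(mulIf B0)/eqP; rewrite eqr_nat eq_sym.
Qed.

Lemma spaced_occupied w p (a : 'I_base) :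
  occupied a (\pi_(unlabelled r) (spaced w p)) <->
  (m %| p)%N /\ a = w (- (p %/ m)%:Z).
Proof.
rewrite occupied_pi; split => [[i /= /int_offset_eq[ip ->]]|[mp ->]].
  have pE : p%:Z = - i * m%:Z by apply/eqP; rewrite mulNr -addr_eq0 addrC ip.
  have mp : (m %| p)%N.
    by rewrite -[m]/`|m%:Z|%N -[p]/`|p%:Z|%N pE abszM dvdn_mull.
  split => //; congr (w _); move: pE.
  rewrite -{1}(divnK mp) PoszM => /(mulIf _) ->; first by rewrite opprK.
  by rewrite eqz_nat -lt0n spacing_gt0.
exists (- (p %/ m)%:Z); rewrite /= /spaced_position mulNr -PoszM divnK//.
by rewrite addNr mul0r add0r.
Qed.

Lemma symbolP w p (a : 'I_base.+1) :
  offset_partition a (\pi_(unlabelled r) (spaced w p)) <-> a = symbol w p.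
Proof.
set q := \pi_(unlabelled r) (spaced w p).
have occN k : (k < symbol w p)%N -> ~ occupied k q.
  move=> ks; have kb : (k < base)%N.
    by apply: leq_trans ks _; rewrite -ltnS ltn_ord.
  rewrite -[k]/(val (Ordinal kb)) => /spaced_occupied[mp kE].
  by move: ks; rewrite /symbol mp /= -kE ltnn.
have sq : offset_partition (symbol w p) q.
  split; last by rewrite -bigcup_mkord => -[k /= /occN].
  rewrite /symbol; case: ifP => mp /=; first exact/spaced_occupied.
  by rewrite /occupied insubF// ltnn.
split => [aq|->//]; have [_ tP _] := offset_partitionP.
by apply: (tP a (symbol w p)) => //; exists q.
Qed.

(** The letters are independent and uniform as soon as [f] is injective; [f] is
    kept general because the shifted word is another word of this form. *)
Definition random_word (f : int -> nat) (u : R) (i : int) : 'I_base :=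
  digit b (f i) u.

Definition random_spaced f p (u : measurableTypeR R) : configuration r :=
  spaced (random_word f u) p.

Lemma random_spaced_cylinder f p (I : set int) (C : int -> set R) :
  random_spaced f p @^-1`
    [set x : configuration r | forall i, I i -> C i (x i)] =
  [set u | forall i, I i ->
    `[< C i ((i * m%:Z + p%:Z)%:~R * v + offset (digit b (f i) u)) >]].
Proof.
apply/seteqP; split => u /= h i Ii; last by move/asboolP: (h i Ii).
by apply/asboolP; exact: h.
Qed.

Lemma measurable_random_spaced f p : measurable_fun setT (random_spaced f p).
Proof.
apply: (measurability (@finite_cylinders R r) erefl).
move=> _ [_ [I [C [finI _ ->]]] <-]; rewrite setTI random_spaced_cylinder.
rewrite (_ : mkset _ = \bigcap_(i in I) [set u |
    `[< C i ((i * m%:Z + p%:Z)%:~R * v + offset (digit b (f i) u)) >]]); last first.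
  by apply/seteqP; split.
apply: fin_bigcap_measurable => // i _.
exact: (measurable_digit (f i) (fun a => `[< C i (_ + offset a) >])).
Qed.

HB.instance Definition _ f p :=
  isMeasurableFun.Build _ _ _ _ (random_spaced f p)
    (measurable_random_spaced f p).

Lemma setI_closed_cylinders : setI_closed (@finite_cylinders R r).
Proof.
move=> _ _ [I [C [finI oC ->]]] [J [D [finJ oD ->]]].
exists (I `|` J), (fun i => [set y | (I i -> C i y) /\ (J i -> D i y)]); split.
- by rewrite finite_setU.
- move=> i; have [oCi iCi] := oC i; have [oDi iDi] := oD i.
  pose C' := if `[< I i >] then C i else setT.
  pose D' := if `[< J i >] then D i else setT.
  have -> : [set y | (I i -> C i y) /\ (J i -> D i y)] = C' `&` D'.
    rewrite /C' /D'; case: asboolP => Ii; case: asboolP => Ji;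
      by apply/seteqP; split => y /=; tauto.
  split.
    by apply: openI; rewrite /C' /D'; case: ifP => // _; exact: openT.
  have iC' : is_interval C' by rewrite /C'; case: ifP.
  have iD' : is_interval D' by rewrite /D'; case: ifP.
  move=> x y [Cx Dx] [Cy Dy] z xzy; split; [exact: (iC' x y)|exact: (iD' x y)].
- apply/seteqP; split => x /= => [[h k] i _|h]; first by split; [exact: h|exact: k].
  split=> i Hi; first exact: (proj1 (h i (or_introl Hi))).
  exact: (proj2 (h i (or_intror Hi))).
Qed.

(** Stationarity of the random word: on cylinders both sides are the same
    product of letter counts. *)
Lemma random_spaced_law f g p (A : set (configuration r)) :
  injective f -> injective g -> measurable A ->
  unit_measure (random_spaced f p @^-1` A) =
  unit_measure (random_spaced g p @^-1` A).
Proof.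
move=> f_inj g_inj mA.
have uniqueness := @measure_unique _ R (configuration r)
  (@finite_cylinders R r) (fun=> setT) erefl setI_closed_cylinders _ _
  (distribution (@unit_measure R) (random_spaced f p))
  (distribution (@unit_measure R) (random_spaced g p)).
apply: uniqueness => //.
- move=> _; exists set0, (fun=> setT); split => //.
    by move=> _; split; [exact: openT|].
  by apply/seteqP; split.
- by apply/seteqP; split => // x _; exists 0%N.
- move=> _ [I [C [/finite_seqP[s ->] _ ->]]].
  pose cylinder := [set x : configuration r | forall i, i \in s -> C i (x i)].
  change (unit_measure (random_spaced f p @^-1` cylinder) =
          unit_measure (random_spaced g p @^-1` cylinder)).
  rewrite /cylinder !random_spaced_cylinder.
  pose D i : pred 'I_base :=
    fun a => `[< C i ((i * m%:Z + p%:Z)%:~R * v + offset a) >].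
  have E h : injective h ->
      unit_measure [set u : R | forall i, i \in s -> D i (digit b (h i) u)] =
      (\prod_(i <- undup s) (#|D i|%:R / base%:R))%:E.
    move=> h_inj; rewrite -(digits_independent D h_inj (undup_uniq s)).
    congr (unit_measure _); apply/seteqP.
    by split => u /= H i; move: (H i); rewrite mem_undup.
  by rewrite (E f)// (E g).
- by move=> _; rewrite (le_lt_trans (probability_le1 _ _))// ltry.
Qed.

Definition phase p (u : measurableTypeR R) : unlabelled r :=
  \pi_(unlabelled r) (random_spaced pickle p u).

Lemma measurable_phase p : measurable_fun setT (phase p).
Proof.
move=> _ A mA.
have {}mA : measurable (\pi_(unlabelled r) @^-1` A).
  by rewrite -unlabelled_measurableE.
exact: (measurable_random_spaced pickle p measurableT mA).
Qed.

HB.instance Definition _ p :=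
  isMeasurableFun.Build _ _ _ _ (phase p) (measurable_phase p).

(** [spaced_relabel] moves the period into the word, where the law does not see
    it. *)
Lemma phase_period p (A : set (unlabelled r)) : measurable A ->
  unit_measure (phase (p + m) @^-1` A) = unit_measure (phase p @^-1` A).
Proof.
move=> mA.
have {}mA : measurable (\pi_(unlabelled r) @^-1` A).
  by rewrite -unlabelled_measurableE.
have sub_inj : injective (fun i : int => pickle (i - 1)).
  by move=> i j /(pcan_inj pickleK)/addIr.
rewrite -[RHS](random_spaced_law p sub_inj (pcan_inj pickleK) mA).
congr (unit_measure _); apply/seteqP.
by split => u /=; rewrite /phase /random_spaced spaced_relabel.
Qed.

(** The components are the phases [1, ..., m] rather than [0, ..., m - 1]: the
    component [k] then reveals the blocks [-1, -2, ...], exactly [(n + k) / m] of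
    them in [n] steps. *)
Definition mixture : set (unlabelled r) -> \bar R :=
  mscale (m%:R^-1)%:nng
    (msum (fun k => distribution (@unit_measure R) (phase k.+1)) m).

HB.instance Definition _ := Measure.copy mixture
  (mscale (m%:R^-1)%:nng
    (msum (fun k => distribution (@unit_measure R) (phase k.+1)) m)).

Lemma mixtureE A :
  mixture A = ((m%:R^-1)%:E * \sum_(k < m) unit_measure (phase k.+1 @^-1` A))%E.
Proof. by []. Qed.

Lemma mixtureT : mixture setT = 1%E.
Proof.
rewrite mixtureE (eq_bigr (fun=> 1%:E)); last first.
  by move=> k _; exact: probability_setT.
rewrite sumEFin sumr_const card_ord -EFinM mulVf// pnatr_eq0 -lt0n.
exact: spacing_gt0.
Qed.

HB.instance Definition _ := Measure_isProbability.Build _ _ R mixture mixtureT.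

Lemma phase_traffic p (A : set (unlabelled r)) :
  phase p @^-1` (traffic_map v_gt0 @^-1` A) = phase p.+1 @^-1` A.
Proof.
apply/seteqP.
by split=> u /=; rewrite /phase /random_spaced traffic_map_pi traffic_spaced.
Qed.

(** The map permutes the phases cyclically; the last one returns to the first in
    law only. *)
Lemma mixture_invariant : invariant_measure (traffic_map v_gt0) mixture.
Proof.
move=> A mA; change (mixture (traffic_map v_gt0 @^-1` A) = mixture A).
rewrite !mixtureE; congr (_ * _)%E.
under eq_bigr do rewrite phase_traffic.
have := spacing_gt0; have := phase_period 1 mA; rewrite add1n.
case: (m) => // k e _.
by rewrite big_ord_recr [RHS]big_ord_recl addeC; congr (_ + _)%E.
Qed.

(** An itinerary that shows a particle at a time when no block starts in the
    window [0, v), or none at a time when one does, is impossible; any other one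
    prescribes exactly one offset in each of the [(n + k) / m] blocks seen. *)
Lemma phase_join k n (w : {ffun 'I_n -> 'I_base.+1}) : (k < m)%N ->
  let q := unit_measure (phase k.+1 @^-1`
    join_partition (traffic_map v_gt0) offset_partition w) in
  q = 0%E \/ q = (base%:R ^- ((n + k) %/ m))%:E.
Proof.
move=> km; set E := _ @^-1` _; cbv zeta.
have EE : E =
    [set u | forall j : 'I_n, w j = symbol (random_word pickle u) (k.+1 + j)].
  apply/seteqP; split => u /= h j.
    have := h j Logic.I.
    by rewrite /= /phase /random_spaced iter_traffic_spaced => /symbolP.
  by move=> _ /=; rewrite /phase /random_spaced iter_traffic_spaced; apply/symbolP.
(* The blocks seen up to time [n - 1], numbered backwards from [-1]. *)
pose c := ((n + k) %/ m)%N.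
pose s : seq int := [seq - (t.+1)%:Z | t <- iota 0 c].
have m0 := spacing_gt0.
have us : uniq s by rewrite map_inj_uniq ?iota_uniq// => t t'; lia.
(* Letters of block [i] compatible with [w]: the block is in the window at the
   time [j] for which [k.+1 + j = |i| m]. *)
pose D (i : int) : pred 'I_base := fun a =>
  [forall j : 'I_n, (k.+1 + j == `|i| * m)%N ==>
    (w j == widen_ord (leqnSn base) a)].
have [/existsP[j /andP[mj wj]]|] :=
    boolP [exists j : 'I_n, ~~ (m %| k.+1 + j)%N && (w j != ord_max)].
  left; rewrite EE (_ : mkset _ = set0) ?measure0//.
  apply/seteqP; split => // u /= /(_ j).
  by rewrite /symbol (negbTE mj); exact/eqP.
rewrite negb_exists => /forallP wmax.
have {}EE : E = [set u | forall i, i \in s -> D i (digit b (pickle i) u)].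
  rewrite EE; apply/seteqP; split => u /= h.
    move=> _ /mapP[t _ ->]; apply/forallP => j; apply/implyP => /eqP jt.
    by rewrite h /symbol jt abszN absz_nat dvdn_mull// mulnK.
  move=> j; have := wmax j; rewrite /symbol negb_and negbK.
  case: ifP => [mj _|_ /= /negPn/eqP//].
  have jq : ((k.+1 + j) %/ m * m = k.+1 + j)%N by rewrite divnK.
  have q0 : (0 < (k.+1 + j) %/ m)%N by rewrite divn_gt0// dvdn_leq// addSn.
  have qs : - ((k.+1 + j) %/ m)%:Z \in s.
    apply/mapP; exists ((k.+1 + j) %/ m).-1; last by rewrite prednK.
    rewrite mem_iota/= add0n prednK// leq_div2r// addSn -addnS addnC.
    by rewrite leq_add2r.
  have := h _ qs => /forallP/(_ j)/implyP; rewrite abszN absz_nat jq eqxx.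
  by move=> /(_ isT)/eqP.
have D1 i : i \in s -> (#|D i| <= 1)%N.
  move=> /mapP[t]; rewrite mem_iota/= add0n => tc ->.
  have tm : (t.+1 * m <= n + k)%N.
    by apply: leq_trans (leq_trunc_div _ m); rewrite leq_mul2r tc orbT.
  have tk : (k < t.+1 * m)%N by apply: leq_trans km _; rewrite leq_pmull.
  have jn : (t.+1 * m - k.+1 < n)%N by lia.
  apply/card_le1_eqP => a a'; rewrite !unfold_in.
  have e : (k.+1 + Ordinal jn == `|- (t.+1)%:Z| * m)%N.
    by rewrite abszN absz_nat /= subnKC.
  move=> /forallP/(_ (Ordinal jn))/implyP/(_ e)/eqP wa.
  move=> /forallP/(_ (Ordinal jn))/implyP/(_ e)/eqP wa'.
  by apply: ord_inj; exact: (congr1 (@nat_of_ord _) (etrans (esym wa') wa)).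
have pick_inj : injective (pickle : int -> nat) := pcan_inj pickleK.
rewrite EE (digits_independent D pick_inj us).
(* A block has no compatible letter when [w] shows no particle at its time. *)
have [/hasP[i si /eqP Di0]|/hasPn Dn0] :=
  boolP (has (fun i => #|D i| == 0%N) s).
  by left; congr EFin; rewrite (big_rem i)//= Di0 mul0r mul0r.
right; congr EFin; rewrite (eq_big_seq (fun=> base%:R^-1)); last first.
  move=> i si; rewrite (_ : #|D i| = 1%N) ?mul1r//.
  by apply/eqP; rewrite eqn_leq D1// lt0n Dn0.
by rewrite big_const_seq count_predT size_map size_iota iter_mulr mulr1 exprVn.
Qed.

(** The upper bound holds for each component; an itinerary of nonzero mass has
    nonzero mass in some component, which alone gives the lower bound. *)
Lemma mixture_join n (w : {ffun 'I_n -> 'I_base.+1}) :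
  let q := fine (mixture
    (join_partition (traffic_map v_gt0) offset_partition w)) in
  q != 0 -> m%:R^-1 * base%:R ^- (n %/ m).+1 <= q <= base%:R ^- (n %/ m).
Proof.
cbv zeta; set J := join_partition _ _ _.
pose x (k : 'I_m) := fine (unit_measure (phase k.+1 @^-1` J)).
have m0 := spacing_gt0.
have m0R : 0 < m%:R :> R by rewrite ltr0n.
have xP k : x k = 0 \/ x k = base%:R ^- ((n + k) %/ m).
  by rewrite /x; case: (phase_join w (ltn_ord k)) => /= ->; [left|right].
have base_le i j : (i <= j)%N -> base%:R ^- j <= base%:R ^- i :> R.
  move=> ij; rewrite lef_pV2 ?posrE ?exprn_gt0//.
  by apply: ler_weXn2l => //; rewrite ler1n.
have xE (k : 'I_m) : unit_measure (phase k.+1 @^-1` J) = (x k)%:E.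
  by rewrite /x; case: (phase_join w (ltn_ord k)) => /= ->.
have qE : fine (mixture J) = m%:R^-1 * \sum_(k < m) x k.
  by rewrite mixtureE (eq_bigr (fun k => (x k)%:E)) ?sumEFin.
have x0 k : 0 <= x k by case: (xP k) => ->; rewrite ?invr_ge0 ?exprn_ge0.
rewrite qE mulf_eq0 negb_or => /andP[_ sn0]; apply/andP; split; last first.
  rewrite mulrC ler_pdivrMr// mulr_natr -[X in _ *+ X]card_ord -sumr_const.
  apply: ler_sum => k _; case: (xP k) => ->.
    by rewrite invr_ge0 exprn_ge0.
  by apply: base_le; rewrite leq_div2r// leq_addr.
rewrite ler_pM2l ?invr_gt0//.
have [k xk] : exists k, x k != 0.
  apply/existsP; apply: contraNT sn0; rewrite negb_exists => /forallP h.
  by rewrite big1// => k _; apply/eqP; rewrite -[_ == _]negbK.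
rewrite (bigD1 k)//=; apply: ler_wpDr; first exact: sumr_ge0.
case: (xP k) => xkE; first by rewrite xkE eqxx in xk.
rewrite xkE; apply: base_le.
have -> : (n %/ m).+1 = ((n + m) %/ m)%N.
  by rewrite divnDr ?dvdnn// divnn m0 addn1.
by rewrite leq_div2r// leq_add2l ltnW.
Qed.

End FreeFlow.

Theorem theorem6 (R : realType) (r v : R) (r_ge0 : 0 <= r) (v_gt0 : 0 < v) :
  topological_entropy R (traffic_map (r := r) v_gt0) = +oo%E.
Proof.
pose m := (Num.truncn ((v + v + (r + r)) / v)).+1.
have room : v + v + (r + r) <= m%:R * v.
  by rewrite -ler_pdivrMr// ltW// truncnS_gt.
have m0 : 0 < m%:R :> R by [].
apply/eqyP => M M0.
(* Enough offsets for [ln b.+1 / m >= M]. *)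
pose b := Num.truncn (expR (m%:R * M)).
pose mu := mixture v_gt0 b room.
apply: (@le_trans _ _ (metric_entropy (traffic_map v_gt0) mu)); last first.
  by apply: ereal_sup_ubound; exists mu => //; exact: mixture_invariant.
apply: (@le_trans _ _ (ln (b.+1%:R : R) / m%:R)%:E).
  rewrite lee_fin ler_pdivlMr// mulrC -[leLHS]expRK ler_ln ?posrE ?expR_gt0//.
  by rewrite ltW// truncnS_gt.
apply: ereal_sup_ubound; exists b.+2, (@offset_partition R r v b).
split; first exact: offset_partitionP.
rewrite (@entropy_wrt_uniform _ _ _ _ _ _ _ m b.+1)//.
- exact: measurable_traffic_map.
- exact: offset_partitionP.
- exact: mixture_join.
Qed.
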